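(* Fix any integer $n \ge 2$. For every $\varepsilon > 0$ there is no constant $C > 0$ such that $$F(\boldsymbol{a}) \le C \cdot (a_1 a_n)^{1-\varepsilon}$$ holds for all vectors $\boldsymbol{a} = (a_1,\ldots,a_n)^T \in \mathbb{Z}^n_{>0}$ with $\gcd(a_1,\ldots,a_n) = 1$ and $a_1 \le a_2 \le \cdots \le a_n$.
   Context: For $\boldsymbol{a} = (a_1,\ldots,a_n)^T \in \mathbb{Z}^n_{>0}$ with $n\ge 2$ and $\gcd(a_1,\ldots,a_n)=1$, the Frobenius number is $F(\boldsymbol{a}) := \max\{ b \in \mathbb{Z} : b \neq \boldsymbol{a}^T \boldsymbol{z} \text{ for all } \boldsymbol{z} \in \mathbb{Z}^n_{\ge 0}\}$, the largest integer not representable as a nonnegative integer combination of $a_1,\ldots,a_n$. *)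

(* Defs.v *)
From mathcomp Require Import all_boot all_order all_algebra.
From mathcomp Require Import boolp classical_sets reals exp.

Set Implicit Arguments.
Unset Strict Implicit.
Unset Printing Implicit Defensive.

Import Order.TTheory GRing.Theory Num.Theory.
Local Open Scope ring_scope.
Local Open Scope classical_set_scope.

Definition first_ord (n : nat) (hn : (1 < n)%N) : 'I_n := Ordinal (ltnW hn).

Definition last_ord (n : nat) (hn : (1 < n)%N) : 'I_n := rev_ord (first_ord hn).

Lemma last_ordE (n : nat) (hn : (1 < n)%N) : last_ord hn = n.-1 :> nat.
Proof. by rewrite /= subn1. Qed.

Definition nonrepresentable (n : nat) (a : 'cV[int]_n) : set int :=
  [set b | forall z : 'cV[int]_n,
     (forall i, 0 <= z i 0) -> b != (a^T *m z) 0 0].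

(* The maximum of [nonrepresentable a]; the default value 0 is only taken when
   there is no maximum, which [frobeniusP] excludes for positive coprime
   entries. *)
Definition frobenius (n : nat) (a : 'cV[int]_n) : int :=
  xget 0 (nonrepresentable a `&` ubound (nonrepresentable a)).

Lemma bezout_cV (n : nat) (a : 'cV[int]_n) :
  exists y : 'cV[int]_n, (a^T *m y) 0 0 = \big[gcdz/0]_i a i 0.
Proof.
suff [f <-] : exists f : 'I_n -> int,
    \sum_i a i 0 * f i = \big[gcdz/0]_i a i 0.
  exists (\col_i f i); rewrite mxE.
  by apply: eq_bigr => i _; rewrite !mxE.
elim: n a => [|n IHn] a; first by exists (fun=> 0); rewrite !big_ord0.
have [f Hf] := IHn (\col_i a (lift ord0 i) 0).
have [u [v Huv]] := Bezoutz (a ord0 0) (\big[gcdz/0]_(i < n) a (lift ord0 i) 0).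
exists (fun i => if unlift ord0 i is Some j then v * f j else u).
rewrite !big_ord_recl unlift_none -Huv mulrC; congr (_ + _).
under eq_bigr => i _ do rewrite liftK mulrCA.
rewrite -mulr_sumr; congr (_ * _).
transitivity (\sum_i (\col_j a (lift ord0 j) 0 : 'cV_n) i 0 * f i).
  by apply: eq_bigr => i _; rewrite mxE.
by rewrite Hf; apply: eq_bigr => i _; rewrite mxE.
Qed.

Lemma frobeniusP (n : nat) (a : 'cV[int]_n) :
  (0 < n)%N -> (forall i, 0 < a i 0) -> \big[gcdz/0]_i a i 0 = 1 ->
  (nonrepresentable a `&` ubound (nonrepresentable a)) (frobenius a).
Proof.
move=> n_gt0 a_gt0 gcd1; rewrite /frobenius.
have dotE (z : 'cV[int]_n) : (a^T *m z) 0 0 = \sum_i a i 0 * z i 0.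
  by rewrite mxE; apply: eq_bigr => i _; rewrite mxE.
have neg1 : nonrepresentable a (-1).
  move=> z z_ge0; rewrite dotE lt_eqF// (@lt_le_trans _ _ 0)//.
  by apply: sumr_ge0 => i _; rewrite mulr_ge0// ltW.
have [y] := bezout_cV a; rewrite gcd1 dotE => Hy.
pose s := \sum_i a i 0.
have s_gt0 : 0 < s.
  rewrite /s (bigD1 (Ordinal n_gt0))//= ltr_wpDr//.
  by apply: sumr_ge0 => i _; exact: ltW.
pose M := \sum_i `|y i 0|.
have yM i : `|y i 0| <= M.
  by rewrite /M (bigD1 i)//= lerDl; apply: sumr_ge0.
have M_ge0 : 0 <= M by apply: sumr_ge0.
have large b : s * M * s <= b -> ~ nonrepresentable a b.
  move=> hb /(_ (\col_i ((b %/ s)%Z + (b %% s)%Z * y i 0))) H.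
  have r_ge0 : 0 <= (b %% s)%Z by rewrite modz_ge0// gt_eqF.
  have r_lt : (b %% s)%Z < s by rewrite ltz_pmod.
  have q_ge : s * M <= (b %/ s)%Z by rewrite lez_divRL.
  have /H : forall i, 0 <= (\col_i ((b %/ s)%Z + (b %% s)%Z * y i 0) : 'cV_n) i 0.
    move=> i; rewrite mxE -lerBlDr sub0r (le_trans _ q_ge)//.
    rewrite (le_trans (ler_norm _))// normrN normrM ger0_norm//.
    by rewrite ler_pM// ltW.
  rewrite dotE => /eqP; apply.
  rewrite {1}(divz_eq b s).
  under eq_bigr => i _ do rewrite mxE mulrDr mulrCA [a i 0 * _]mulrC.
  by rewrite big_split/= -mulr_sumr -mulr_sumr Hy mulr1.
pose P (k : nat) := `[< nonrepresentable a (k%:Z - 1) >].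
have exP : exists k, P k by exists 0%N; apply/asboolP; rewrite sub0r.
have ubP k : P k -> (k <= `|(s * M * s)%R|.+1)%N.
  move=> /asboolP Pk; rewrite leqNgt; apply/negP => hk; case: (large _ _ Pk).
  have : (`|(s * M * s)%R|.+2%:Z <= k%:Z) by rewrite lez_nat.
  rewrite -addn2 PoszD gez0_abs ?mulr_ge0 ?(ltW s_gt0)// => h.
  by rewrite lerBrDr (le_trans _ h)// lerD2l.
case: (ex_maxnP exP ubP) => k /asboolP Pk kmax.
apply: (@xgetPex _ 0 (nonrepresentable a `&` ubound (nonrepresentable a))).
exists (k%:Z - 1); split=> // b Pb.
have [b_lt|b_ge] := ltP b (-1).
  by rewrite (le_trans (ltW b_lt))// lerBrDr addNr.
have e : (`|(b + 1)%R|%N%:Z - 1) = b.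
  by rewrite gez0_abs ?addrK// -[1]opprK subr_ge0.
have /kmax : P `|(b + 1)%R|%N by apply/asboolP; rewrite e.
by rewrite -lez_nat -(lerD2r (-1)) e.
Qed.

(* Main.v *)
(* For [a = (k, ..., k, k + 1)] the integer [k^2 - k - 1] is not representable,
   so [F(a)] is at least a fixed multiple of [a_1 a_n = k (k + 1)] while
   [(k (k + 1))^eps] is unbounded as [k] grows. *)

Require Import Defs.
From mathcomp Require Import all_boot all_order all_algebra.
From mathcomp Require Import boolp classical_sets reals exp.
From mathcomp Require Import zify lra.

Set Implicit Arguments.
Unset Strict Implicit.
Unset Printing Implicit Defensive.

Import Order.TTheory GRing.Theory Num.Theory.
Local Open Scope ring_scope.

Definition near_constant (n : nat) (hn : (1 < n)%N) (k : nat) : 'cV[int]_n :=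
  \col_i (k + (i == last_ord hn))%:Z.

Lemma dvdz_big_gcdz (n : nat) (a : 'I_n -> int) (i : 'I_n) :
  (\big[gcdz/0]_j a j %| a i)%Z.
Proof.
elim: n a i => [a [//]|n IHn a i]; rewrite big_ord_recl.
case: (unliftP ord0 i) => [j|] ->; last exact: dvdz_gcdl.
by apply: dvdz_trans (dvdz_gcdr _ _) (IHn (fun j => a (lift ord0 j)) j).
Qed.

Lemma big_gcdz_ge0 (n : nat) (a : 'I_n -> int) : 0 <= \big[gcdz/0]_j a j.
Proof. by elim/big_rec: _. Qed.

Lemma eq_last_ord (n : nat) (hn : (1 < n)%N) (i : 'I_n) :
  (i == last_ord hn) = (i == n.-1 :> nat).
Proof. by rewrite -(last_ordE hn). Qed.

Lemma first_neq_last (n : nat) (hn : (1 < n)%N) : first_ord hn != last_ord hn.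
Proof. by rewrite eq_last_ord /=; lia. Qed.

(** The gcd divides the first and last entries, [k] and [k + 1], which sit at different positions as
    [n >= 2]; so it divides 1, and being nonnegative it equals 1. *)
Lemma near_constant_gcd (n : nat) (hn : (1 < n)%N) (k : nat) :
  \big[gcdz/0]_i near_constant hn k i 0 = 1.
Proof.
set a := fun i => near_constant hn k i 0.
have := dvdz_big_gcdz a (last_ord hn); have := dvdz_big_gcdz a (first_ord hn).
have := big_gcdz_ge0 a; set g := \big[gcdz/0]_i a i => g_ge0.
rewrite /a !mxE eqxx (negPf (first_neq_last hn)) addn0 PoszD => gk.
rewrite rpredDl// dvdz1 => /eqP g1.
by rewrite -(gez0_abs g_ge0) g1.
Qed.

Lemma near_constant_mono (n : nat) (hn : (1 < n)%N) (k : nat) (i j : 'I_n) :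
  (i <= j)%N -> near_constant hn k i 0 <= near_constant hn k j 0.
Proof.
rewrite !mxE lez_nat leq_add2l !eq_last_ord.
by have := ltn_ord j; lia.
Qed.

Lemma near_constant_nonrepresentable (n : nat) (hn : (1 < n)%N) (k : nat) :
  nonrepresentable (near_constant hn k) (k%:Z * k%:Z - k%:Z - 1).
Proof.
move=> z z_ge0; set y := z (last_ord hn) 0; set x := \sum_i z i 0.
(* Every coordinate of [z] is weighted by [k], and the last one once more by 1, so the value depends
   only on the total [x] and the last coordinate [y]. *)
have -> : ((near_constant hn k)^T *m z) 0 0 = k%:Z * x + y.
  rewrite mxE mulr_sumr (bigD1 (last_ord hn))//= [in RHS](bigD1 (last_ord hn))//=.
  rewrite !mxE eqxx PoszD mulrDl mul1r addrAC; congr (_ + _ + _).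
  by apply: eq_bigr => i /negPf ni; rewrite !mxE ni addn0.
have y_ge0 : 0 <= y by exact: z_ge0.
have yx : y <= x by rewrite /x (bigD1 (last_ord hn))//= lerDl sumr_ge0.
(* [k x + y] with [0 <= y <= x] jumps over [k^2 - k - 1] between [x = k - 2]
   and [x = k - 1]. *)
apply/eqP; have [xk|xk] := leP (k%:Z - 1) x; nia.
Qed.

Lemma near_constant_frobenius (n : nat) (hn : (1 < n)%N) (k : nat) :
  (0 < k)%N -> k%:Z * k%:Z - k%:Z - 1 <= frobenius (near_constant hn k).
Proof.
move=> k_gt0; have [||_] := @frobeniusP n (near_constant hn k) (ltnW hn).
- by move=> i; rewrite mxE ltz_nat addn_gt0 k_gt0.
- exact: near_constant_gcd.
- by apply; exact: near_constant_nonrepresentable.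
Qed.

Theorem theorem1 (R : realType) (n : nat) (hn : (1 < n)%N)
  (eps : R) (heps : 0 < eps) :
  ~ exists C : R, 0 < C /\
    forall a : 'cV[int]_n,
      (forall i, 0 < a i 0) ->
      \big[gcdz/0]_i a i 0 = 1 ->
      (forall i j : 'I_n, (i <= j)%N -> a i 0 <= a j 0) ->
      (frobenius a)%:~R <=
        C * (a (first_ord hn) 0 * a (last_ord hn) 0)%:~R `^ (1 - eps).
Proof.
case=> C [C_gt0 bound].
(* Chosen so that [t] to the power [eps] is [4 * C]; the 4 pays for the factor lost in [F_ge]. *)
pose t := (4 * C) `^ eps^-1.
(* Besides [t < k] this ensures [k >= 3], the first integer from which
   [k (k + 1) / 4 <= k^2 - k - 1]. *)
pose k := (Num.bound t).+3.
have t_ge0 : 0 <= t by exact: powR_ge0.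
have t_lt : t < k%:R.
  by rewrite (lt_trans (archi_boundP t_ge0))// ltr_nat; lia.
have a_gt0 i : 0 < near_constant hn k i 0 by rewrite mxE.
have := bound _ a_gt0 (near_constant_gcd hn k) (near_constant_mono hn k).
rewrite !mxE eqxx (negPf (first_neq_last hn)) addn0 => bound_k.
have k_ge3 : 3 <= k%:R :> R by rewrite ler_nat.
have : (k%:Z * k%:Z - k%:Z - 1)%:~R <= (frobenius (near_constant hn k))%:~R :> R.
  by rewrite ler_int near_constant_frobenius.
move=> /le_trans/(_ bound_k).
rewrite addn1 -addn1 PoszD !rmorphB !rmorphM rmorphD /= -!pmulrn.
set K := k%:R in t_lt k_ge3 *; set N := K * (K + 1).
have N_gt0 : 0 < N by rewrite /N; nra.
have P_gt0 : 0 < N `^ eps by exact: powR_gt0.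
(* Splitting the power [1 - eps] and clearing the denominator turns the assumed bound into
   [(K^2 - K - 1) * N^eps <= C * N]. *)
rewrite powRB ?(gt_eqF N_gt0) ?implybT// powRr1 ?(ltW N_gt0)// mulrA ler_pdivlMr// => F_le.
(* Monotonicity of the power, since [t < K < N]. *)
have C_lt : 4 * C < N `^ eps.
  have -> : 4 * C = t `^ eps.
    by rewrite /t -powRrM mulVf ?gt_eqF// powRr1// mulr_ge0// ltW.
  by rewrite gt0_ltr_powR// ?nnegrE ?(ltW N_gt0)// /N; nra.
have F_ge : N / 4 <= K * K - K - 1 by rewrite /N; nra.
(* This gives [N / 4 * N^eps <= C * N], against [C_lt] multiplied by [N > 0]. *)
have := le_trans (ler_wpM2r (ltW P_gt0) F_ge) F_le.
by apply/negP; rewrite -ltNge; move: C_lt; rewrite -(ltr_pM2r N_gt0); lra.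
Qed.
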